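(* Let $\mathcal{R}$ be a commutative ring with unity, let $\mathcal{A}$ and $\mathcal{B}$ be $\mathcal{R}$-algebras, let $\mathcal{M}$ be an $(\mathcal{A},\mathcal{B})$-bimodule, and suppose that the triangular algebra $\mathcal{T}=Tri(\mathcal{A},\mathcal{M},\mathcal{B})$ is a SLIP algebra. Then $\mathcal{B}$ is a SLIP algebra and every local left multiplier from $\mathcal{B}$ into $\mathcal{M}$ is a left multiplier.
   Context: All algebras are associative $\mathcal{R}$-algebras with unity $1$ and all modules and bimodules are unital; modules over an $\mathcal{R}$-algebra are $\mathcal{R}$-modules in the compatible way (for bimodules, $rm=mr$ for $r\in\mathcal{R}$). The triangular algebra $Tri(\mathcal{A},\mathcal{M},\mathcal{B})$ is the algebra of all matrices $\begin{pmatrix} a & m\\ 0 & b\end{pmatrix}$ with $a\in\mathcal{A}$, $b\in\mathcal{B}$, $m\in\mathcal{M}$, under the usual matrix operations. For an algebra $\mathcal{C}$ and a right $\mathcal{C}$-module $\mathcal{X}$, an $\mathcal{R}$-linear map $\psi:\mathcal{C}\to\mathcal{X}$ is a left multiplier if $\psi(c)=\psi(1)c$ for all $c\in\mathcal{C}$; it is a local left multiplier if for each $c\in\mathcal{C}$ there exists $x_c\in\mathcal{X}$ with $\psi(c)=x_c c$. An $\mathcal{R}$-linear map $\psi:\mathcal{C}\to\mathcal{C}$ is LIP (left-ideal-preserving) if $\psi(\mathcal{J})\subseteq\mathcal{J}$ for every left ideal $\mathcal{J}$ of $\mathcal{C}$ (equivalently, $\psi$ is a local left multiplier from $\mathcal{C}$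 to $\mathcal{C}$). The algebra $\mathcal{C}$ is SLIP if every LIP map on $\mathcal{C}$ is a left multiplier. *)

(* Defs.v *)
From HB Require Import structures.
From mathcomp Require Import all_boot all_algebra.

Set Implicit Arguments.
Unset Strict Implicit.
Unset Printing Implicit Defensive.

Import GRing.Theory.
Local Open Scope ring_scope.

(* MathComp's [algType R] forces 1 != 0 and its hierarchy has no algebras over *)
(* [pzRingType]; [assocAlgType R] has the axioms of [algType R] except 1 != 0, *)
(* so that the zero algebra is allowed.                                        *)
HB.mixin Record Lmodule_isAssocAlgebra (R : comPzRingType) A
    of GRing.Lmodule R A := {
  aone : A;
  amul : A -> A -> A;
  amulA : associative amul;
  amul1l : left_id aone amul;
  amul1r : right_id aone amul;
  amulDl : left_distributive amul +%R;
  amulDr : right_distributive amul +%R;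
  amulZl : forall (r : R) x y, amul (r *: x) y = r *: amul x y;
  amulZr : forall (r : R) x y, amul x (r *: y) = r *: amul x y
}.

#[short(type="assocAlgType")]
HB.structure Definition AssocAlgebra (R : comPzRingType) :=
  {A of GRing.Lmodule R A & Lmodule_isAssocAlgebra R A}.

Notation "x ** y" := (amul x y) (at level 40, left associativity) : ring_scope.

Section LibraryAlgebras.
Variables (R : comPzRingType) (A : algType R).

HB.instance Definition _ := @Lmodule_isAssocAlgebra.Build R A 1 *%R
  (@mulrA A) (@mul1r A) (@mulr1 A) (@mulrDl A) (@mulrDr A)
  (fun r x y => esym (scalerAl r x y)) (fun r x y => esym (scalerAr r x y)).

End LibraryAlgebras.

(* In the next three structures the [lmodType R] structure of X is the action  *)
(* of the base ring; the algebras act through [lact] and [ract].               *)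
HB.mixin Record Lmodule_isLeftModule (R : comPzRingType) (A : assocAlgType R) X
    of GRing.Lmodule R X := {
  lact : A -> X -> X;
  lactA : forall a a' x, lact a (lact a' x) = lact (a ** a') x;
  lact1 : forall x, lact aone x = x;
  lactDl : forall a a' x, lact (a + a') x = lact a x + lact a' x;
  lactDr : forall a x x', lact a (x + x') = lact a x + lact a x';
  lactZl : forall (r : R) a x, lact (r *: a) x = r *: lact a x;
  lactZr : forall (r : R) a x, lact a (r *: x) = r *: lact a x
}.

#[short(type="leftModType")]
HB.structure Definition LeftModule (R : comPzRingType) (A : assocAlgType R) :=
  {X of GRing.Lmodule R X & Lmodule_isLeftModule R A X}.

HB.mixin Record Lmodule_isRightModule (R : comPzRingType) (C : assocAlgType R) X
    of GRing.Lmodule R X := {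
  ract : X -> C -> X;
  ractA : forall x c c', ract (ract x c) c' = ract x (c ** c');
  ract1 : forall x, ract x aone = x;
  ractDl : forall x x' c, ract (x + x') c = ract x c + ract x' c;
  ractDr : forall x c c', ract x (c + c') = ract x c + ract x c';
  ractZl : forall (r : R) x c, ract (r *: x) c = r *: ract x c;
  ractZr : forall (r : R) x c, ract x (r *: c) = r *: ract x c
}.

#[short(type="rightModType")]
HB.structure Definition RightModule (R : comPzRingType) (C : assocAlgType R) :=
  {X of GRing.Lmodule R X & Lmodule_isRightModule R C X}.

HB.mixin Record LeftRight_isBimodule (R : comPzRingType) (A B : assocAlgType R) X
    of LeftModule R A X & RightModule R B X := {
  lractA : forall (a : A) (x : X) (b : B),
    ract (lact a x) b = lact a (ract x b)
}.

#[short(type="bimodType")]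
HB.structure Definition Bimodule (R : comPzRingType) (A B : assocAlgType R) :=
  {X of LeftModule R A X & RightModule R B X & LeftRight_isBimodule R A B X}.

Definition regular_right (R : comPzRingType) (C : assocAlgType R) : Type := C.

Section RegularRight.
Variables (R : comPzRingType) (C : assocAlgType R).

HB.instance Definition _ := GRing.Lmodule.on (regular_right C).

HB.instance Definition _ :=
  @Lmodule_isRightModule.Build R C (regular_right C) (fun x c : C => x ** c)
    (fun x c c' => esym (amulA x c c')) (@amul1r R C) (@amulDl R C) (@amulDr R C)
    (@amulZl R C) (@amulZr R C).

End RegularRight.

(* [Tri a m b] is the matrix with rows (a, m) and (0, b).                      *)
Record triangular (R : comPzRingType) (A : assocAlgType R) (B : assocAlgType R)
    (M : bimodType A B) := Tri { tri11 : A; tri12 : M; tri22 : B }.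

Section Triangular.
Variables (R : comPzRingType) (A B : assocAlgType R) (M : bimodType A B).
Local Notation T := (triangular M).
Implicit Types s t u : T.

Definition tri_pair t := (tri11 t, tri12 t, tri22 t).
Definition pair_tri (p : A * M * B) : T := Tri p.1.1 p.1.2 p.2.

Lemma tri_pairK : cancel tri_pair pair_tri.
Proof. by case. Qed.

HB.instance Definition _ := Choice.copy T (can_type tri_pairK).

Definition tri_zero : T := Tri 0 0 0.
Definition tri_opp t : T := Tri (- tri11 t) (- tri12 t) (- tri22 t).
Definition tri_add s t : T :=
  Tri (tri11 s + tri11 t) (tri12 s + tri12 t) (tri22 s + tri22 t).
Definition tri_scale (r : R) t : T :=
  Tri (r *: tri11 t) (r *: tri12 t) (r *: tri22 t).
Definition tri_one : T := Tri aone 0 aone.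
Definition tri_mul s t : T :=
  Tri (tri11 s ** tri11 t)
      (lact (tri11 s) (tri12 t) + ract (tri12 s) (tri22 t))
      (tri22 s ** tri22 t).

Lemma lactr0 (a : A) : lact a (0 : M) = 0.
Proof. by apply: (addrI (lact a 0)); rewrite -lactDr !addr0. Qed.

Lemma ract0l (b : B) : ract (0 : M) b = 0.
Proof. by apply: (addrI (ract 0 b)); rewrite -ractDl !addr0. Qed.

Lemma tri_addA : associative tri_add.
Proof. by move=> s t u; congr Tri; rewrite /= addrA. Qed.

Lemma tri_addC : commutative tri_add.
Proof. by move=> s t; congr Tri; rewrite /= addrC. Qed.

Lemma tri_add0 : left_id tri_zero tri_add.
Proof. by case=> a m b; congr Tri; rewrite /= add0r. Qed.

Lemma tri_addN : left_inverse tri_zero tri_opp tri_add.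
Proof. by move=> t; congr Tri; rewrite /= addNr. Qed.

HB.instance Definition _ :=
  GRing.isZmodule.Build T tri_addA tri_addC tri_add0 tri_addN.

Lemma tri_scaleA r r' t : tri_scale r (tri_scale r' t) = tri_scale (r * r') t.
Proof. by congr Tri; rewrite /= scalerA. Qed.

Lemma tri_scale1 : left_id 1 tri_scale.
Proof. by case=> a m b; congr Tri; rewrite /= scale1r. Qed.

Lemma tri_scaleDr : right_distributive tri_scale +%R.
Proof. by move=> r s t; congr Tri; rewrite /= scalerDr. Qed.

Lemma tri_scaleDl t : {morph tri_scale^~ t : r r' / r + r'}.
Proof. by move=> r r'; congr Tri; rewrite /= scalerDl. Qed.

HB.instance Definition _ := GRing.Zmodule_isLmodule.Build R T
  tri_scaleA tri_scale1 tri_scaleDr tri_scaleDl.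

Lemma tri_mulA : associative tri_mul.
Proof.
move=> s t u; congr Tri; rewrite /= ?amulA //.
by rewrite lactDr ractDl lactA ractA lractA addrA.
Qed.

Lemma tri_mul1l : left_id tri_one tri_mul.
Proof. by case=> a m b; congr Tri; rewrite /= ?amul1l // lact1 ract0l addr0. Qed.

Lemma tri_mul1r : right_id tri_one tri_mul.
Proof. by case=> a m b; congr Tri; rewrite /= ?amul1r // ract1 lactr0 add0r. Qed.

Lemma tri_mulDl : left_distributive tri_mul +%R.
Proof.
by move=> s t u; congr Tri; rewrite /= ?amulDl // lactDl ractDl addrACA.
Qed.

Lemma tri_mulDr : right_distributive tri_mul +%R.
Proof.
by move=> s t u; congr Tri; rewrite /= ?amulDr // lactDr ractDr addrACA.
Qed.

Lemma tri_mulZl (r : R) s t : tri_mul (r *: s) t = r *: tri_mul s t.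
Proof. by congr Tri; rewrite /= ?amulZl // lactZl ractZl scalerDr. Qed.

Lemma tri_mulZr (r : R) s t : tri_mul s (r *: t) = r *: tri_mul s t.
Proof. by congr Tri; rewrite /= ?amulZr // lactZr ractZr scalerDr. Qed.

HB.instance Definition _ := Lmodule_isAssocAlgebra.Build R T
  tri_mulA tri_mul1l tri_mul1r tri_mulDl tri_mulDr tri_mulZl tri_mulZr.

End Triangular.

Section Multipliers.
Variables (R : comPzRingType) (C : assocAlgType R).

Definition left_multiplier (X : rightModType C) (psi : {linear C -> X}) : Prop :=
  forall c : C, psi c = ract (psi aone) c.

Definition local_left_multiplier (X : rightModType C) (psi : {linear C -> X}) :
    Prop :=
  forall c : C, exists x : X, psi c = ract x c.

(* Since C is unital, closure under C-multiples gives closure under R-multiples. *)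
Definition left_ideal (J : C -> Prop) : Prop :=
  [/\ J 0, forall x y, J x -> J y -> J (x - y) & forall c x, J x -> J (c ** x)].

Definition LIP (psi : {linear C -> C}) : Prop :=
  forall J : C -> Prop, left_ideal J -> forall x, J x -> J (psi x).

Definition SLIP : Prop :=
  forall psi : {linear C -> C},
    LIP psi -> left_multiplier (psi : {linear C -> regular_right C}).

End Multipliers.

Arguments SLIP {R} C.

(* Main.v *)
From HB Require Import structures.
Require Import Defs.
From mathcomp Require Import all_boot all_algebra.

(** The second column of a matrix in [Tri(A, M, B)] ranges over [M (+) B], and
right multiplication by a matrix with rows (a, m) and (0, b) takes a matrix with
zero first column to one of the same shape, its second column multiplied by b. Hence a pair of local left multipliers
[psi : B -> M] and [phi : B -> B] extends to the triangular algebra: send a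
matrix to the one with zero first column and second column
(psi b, phi b), where b is its lower right entry. If [psi b = x b] and
[phi b = y b], the image is the product of the matrix with zero first column and
second column (x, y) by the given one, so the extension preserves left ideals.
When the triangular algebra is SLIP the extension is therefore a left
multiplier, and reading this off on the matrices with b as sole nonzero entry
gives [psi b = psi 1 b] and [phi b = phi 1 b].

Taking one member of the pair to be zero yields each half of the theorem; for
the half about [B], LIP maps are converted to local left multipliers through
principal left ideals ([LIP_local_left_multiplier],
[local_left_multiplier_LIP]). *)

Set Implicit Arguments.
Unset Strict Implicit.
Unset Printing Implicit Defensive.

Import GRing.Theory.
Local Open Scope ring_scope.

Section LocalLeftMultipliers.
Variables (R : comPzRingType) (C : assocAlgType R).

Lemma amul0l (c : C) : 0 ** c = 0.
Proof. by apply: (addrI (0 ** c)); rewrite -amulDl !addr0. Qed.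

Lemma amulNl (x y : C) : (- x) ** y = - (x ** y).
Proof. by apply: (addrI (x ** y)); rewrite -amulDl !subrr amul0l. Qed.

Lemma left_ideal_principal (c : C) : left_ideal (fun x => exists y, x = y ** c).
Proof.
split=> [|x y [u ->] [v ->]|d x [u ->]].
- by exists 0; rewrite amul0l.
- by exists (u - v); rewrite amulDl amulNl.
- by exists (d ** u); rewrite amulA.
Qed.

(** The image of c lies in the principal left ideal of c, because the unit puts
c itself in that ideal. *)
Lemma LIP_local_left_multiplier (psi : {linear C -> C}) :
  LIP psi ->
  local_left_multiplier (psi : {linear C -> regular_right C}).
Proof.
move=> psiP c; apply: (psiP _ (left_ideal_principal c)).
by exists aone; rewrite amul1l.
Qed.

Lemma local_left_multiplier_LIP (psi : {linear C -> C}) :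
  local_left_multiplier (psi : {linear C -> regular_right C}) -> LIP psi.
Proof.
move=> psiP J [_ _ JM] c Jc; have [x ->] := psiP c.
exact: JM.
Qed.

Lemma local_left_multiplier0 (X : rightModType C) :
  local_left_multiplier (\0 : {linear C -> X}).
Proof.
by move=> c; exists 0; apply: (addrI (ract 0 c)); rewrite -ractDl !addr0.
Qed.

End LocalLeftMultipliers.

Section SecondColumn.
Variables (R : comPzRingType) (A B : assocAlgType R) (M : bimodType A B).
Local Notation T := (triangular M).

Lemma lact0l (m : M) : lact (0 : A) m = 0.
Proof. by apply: (addrI (lact (0 : A) m)); rewrite -lactDl !addr0. Qed.

(** Multiplying a matrix with zero first column by t uses only the lower right
entry of t. *)
Lemma amul_second_column (m : M) (b : B) (t : T) :
  (Tri 0 m b : T) ** t = Tri 0 (ract m (tri22 t)) (b ** tri22 t).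
Proof. by congr Tri; rewrite /= ?amul0l // lact0l add0r. Qed.

Section Extension.
Variables (psi : {linear B -> M}) (phi : {linear B -> B}).

Definition second_column_map (t : T) : T :=
  Tri 0 (psi (tri22 t)) (phi (tri22 t)).

Lemma second_column_map_linear : linear second_column_map.
Proof.
by move=> r s t; congr Tri; rewrite /= ?linearP // scaler0 addr0.
Qed.

HB.instance Definition _ :=
  GRing.isLinear.Build R T T *:%R second_column_map second_column_map_linear.

(** The multipliers x and y of the two entries at b assemble into the single
matrix with second column (x, y). *)
Lemma second_column_map_local :
    local_left_multiplier psi ->
    local_left_multiplier (phi : {linear B -> regular_right B}) ->
  local_left_multiplier (second_column_map : {linear T -> regular_right T}).
Proof.
move=> psiP phiP t.
have [x psiE] := psiP (tri22 t); have [y phiE] := phiP (tri22 t).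
exists (Tri 0 x y); rewrite -[RHS]/((Tri 0 x y : T) ** t) amul_second_column.
by congr Tri; [exact: psiE | exact: phiE].
Qed.

End Extension.

(** Compare the two sides of the multiplier identity for the extension at the
matrix whose only nonzero entry is b, in the lower right corner. *)
Lemma SLIP_triangular_left_multipliers (psi : {linear B -> M})
    (phi : {linear B -> B}) :
    SLIP T ->
    local_left_multiplier psi ->
    local_left_multiplier (phi : {linear B -> regular_right B}) ->
  left_multiplier psi /\
  left_multiplier (phi : {linear B -> regular_right B}).
Proof.
move=> slipT psiP phiP.
have /slipT mulT := local_left_multiplier_LIP (second_column_map_local psiP phiP).
have colE b : Tri 0 (psi b) (phi b)
    = Tri 0 (ract (psi aone) b) (phi aone ** b) :> T.
  have := mulT (Tri 0 0 b); rewrite -[ract _ _]/(amul (_ : T) (_ : T)).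
  by rewrite amul_second_column.
by split=> b; have [] := colE b.
Qed.

End SecondColumn.

Theorem theorem3p6 (R : comPzRingType) (A B : assocAlgType R) (M : bimodType A B) :
  SLIP (triangular M) ->
  SLIP B /\
  (forall psi : {linear B -> M}, local_left_multiplier psi -> left_multiplier psi).
Proof.
move=> slipT; split=> [phi /LIP_local_left_multiplier phiP | psi psiP].
- by have [] := SLIP_triangular_left_multipliers slipT
    (local_left_multiplier0 M) phiP.
- have zeroP : local_left_multiplier
      ((\0 : {linear B -> B}) : {linear B -> regular_right B}).
    exact: local_left_multiplier0.
  by have [] := SLIP_triangular_left_multipliers slipT psiP zeroP.
Qed.
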